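(* Let $p$ be a polygon in $S^2\subset\mathbb{R}^3$, with vertices $v_1, v_2, \ldots, v_n$, edge lengths $l_1,\ldots,l_n\notin\{0,\pi\}$ and exterior angles $\theta_1,\ldots,\theta_n$. For each $i\in\{1,\ldots,n\}$, let $w_i\in S^2$ be the point dual to the oriented edge $e_i:=(v_i,v_{i+1})$. Under any first-order deformation of $p$, the first-order variations $dl_i$ of its edge lengths and $d\theta_i$ of its exterior angles satisfy the equation in $\mathbb{R}^3$ $$\sum_{i=1}^n \bigl(v_i\, d\theta_i - w_i\, dl_i\bigr) = 0 .$$ Conversely, any first-order variation $(l'_1,\ldots,l'_n,\theta'_1,\ldots,\theta'_n)\in\mathbb{R}^{2n}$ which satisfies this equation, i.e. $\sum_{i=1}^n (\theta'_i v_i - l'_i w_i)=0$, corresponds to a first-order deformation of $p$, which is uniquely defined up to the addition of a trivial deformation.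
   Context: $S^2$ is the unit sphere in Euclidean $\mathbb{R}^3$; points of $S^2$ are considered as vectors in $\mathbb{R}^3$. Indices are taken modulo $n$, $l_i$ is the length of $e_i=(v_i,v_{i+1})$ and $\theta_i$ is the exterior angle at $v_i$ ($\pi$ minus the interior angle). The polygon is not assumed convex. The point $w_i$ dual to the oriented edge $e_i$ is the unit vector orthogonal to the plane of $\mathbb{R}^3$ spanned by $e_i$, pointing toward the exterior side of $p$ along $e_i$. A first-order deformation of $p$ is a first-order variation of its vertices (tangent vectors to $S^2$ at the $v_i$); it is trivial if it is induced by an infinitesimal isometry of $S^2$. *)

(* Defs.v *)
From mathcomp Require Import all_boot all_order all_algebra.
From mathcomp Require Import all_classical all_reals all_analysis.
Import Order.TTheory GRing.Theory Num.Theory.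
Import numFieldNormedType.Exports.

Set Implicit Arguments.
Unset Strict Implicit.
Unset Printing Implicit Defensive.

Local Open Scope classical_set_scope.
Local Open Scope ring_scope.

Definition dotv (R : realType) (x y : 'rV[R]_3) : R :=
  \sum_(k < 3) x 0 k * y 0 k.

Definition crossv (R : realType) (x y : 'rV[R]_3) : 'rV[R]_3 :=
  \row_(k < 3) (x 0 (ordS k) * y 0 (ordS (ordS k))
                - x 0 (ordS (ordS k)) * y 0 (ordS k)).

(* The edge from [vtx p i] to [vtx p (ordS i)] is the geodesic arc
   s |-> cos s *: vtx p i + sin s *: dir p i, 0 <= s <= len p i, so [dir p i]
   is its unit velocity at [vtx p i].  Giving the velocity and the length, and
   not just the endpoints, allows arcs longer than pi.  [interior_left] tells
   whether the interior of the polygon lies to the left or to the right of its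
   oriented edges, S^2 being seen from outside the ball. *)
Record polygon (R : realType) (n : nat) := Polygon {
  vtx : 'I_n -> 'rV[R]_3;
  dir : 'I_n -> 'rV[R]_3;
  len : 'I_n -> R;
  int_angle : 'I_n -> R;
  interior_left : bool
}.

Section Polygon.
Context (R : realType) (n : nat).
Implicit Types (p : polygon R n) (i : 'I_n).

(* Unit tangent vector at [vtx p i], orthogonal to the i-th edge and pointing
   to the interior side; it is constant along the edge. *)
Definition inward p i : 'rV[R]_3 :=
  (if interior_left p then 1 else - 1) *: crossv (vtx p i) (dir p i).

Definition dual_point p i : 'rV[R]_3 := - inward p i.

(* Unit tangent vector at [vtx p (ordS i)], pointing back along edge i: the
   opposite of the final velocity of the arc above. *)
Definition back_dir p i : 'rV[R]_3 :=
  sin (len p i) *: vtx p i - cos (len p i) *: dir p i.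

Definition ext_angle p i : R := pi - int_angle p i.

(* The last clause says that turning [dir p i] by [int_angle p i] towards the
   interior gives the direction of the preceding edge: it determines the
   interior angle modulo 2 pi.  The representative is left free, so that the
   angle can vary continuously with the polygon even when two consecutive
   edges overlap.  Embeddedness is not required. *)
Definition is_polygon p : Prop := forall i,
  [/\ dotv (vtx p i) (vtx p i) = 1,
      dotv (dir p i) (dir p i) = 1 /\ dotv (vtx p i) (dir p i) = 0,
      0 <= len p i < 2 * pi,
      vtx p (ordS i) = cos (len p i) *: vtx p i + sin (len p i) *: dir p i
    & back_dir p (ord_pred i) =
        cos (int_angle p i) *: dir p i + sin (int_angle p i) *: inward p i].

Definition deformation p (V : 'I_n -> 'rV[R]_3) : Prop :=
  forall i, dotv (vtx p i) (V i) = 0.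

(* [dl] and [dtheta] are the first-order variations of the edge lengths and of
   the exterior angles under the deformation [V]: derivatives at time 0 along
   a path of polygons starting at [p], whose vertices have initial velocity
   [V]. *)
Definition first_order_variation p (V : 'I_n -> 'rV[R]_3)
    (dl dtheta : 'I_n -> R) : Prop :=
  exists P : R -> polygon R n,
  [/\ P 0 = p,
      \forall t \near (0 : R),
        is_polygon (P t) /\ interior_left (P t) = interior_left p,
      forall i, is_derive (0 : R) (1 : R) (fun t => vtx (P t) i) (V i),
      forall i, is_derive (0 : R) (1 : R) (fun t => len (P t) i) (dl i)
    & forall i, is_derive (0 : R) (1 : R) (fun t => ext_angle (P t) i)
                  (dtheta i)].

End Polygon.

(* Isometries of S^2 are the maps x |-> x *m g with g orthogonal. *)
Definition infinitesimal_isometry (R : realType) (A : 'M[R]_3) : Prop :=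
  exists g : R -> 'M[R]_3,
  [/\ g 0 = 1%:M,
      forall t, g t *m (g t)^T = 1%:M
    & is_derive (0 : R) (1 : R) g A].

Definition trivial_deformation (R : realType) (n : nat) (p : polygon R n)
    (V : 'I_n -> 'rV[R]_3) : Prop :=
  exists2 A : 'M[R]_3, infinitesimal_isometry A &
    forall i, V i = vtx p i *m A.

(* Main.v *)
Require Import Defs.
From mathcomp Require Import all_boot all_order all_algebra ring lra.
From mathcomp Require Import all_classical all_reals all_analysis.
Import Order.TTheory GRing.Theory Num.Theory.
Import numFieldNormedType.Exports.

Set Implicit Arguments.
Unset Strict Implicit.
Unset Printing Implicit Defensive.

Local Open Scope ring_scope.

(** Attach to every vertex [v_i] the orthonormal frame [v_i], [d_i],
    [n_i = v_i x d_i], where [d_i] is the initial direction of the edge [i].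
    Along a path of polygons this frame moves like a rigid body: its velocity
    is [om_i x -] for a vector [om_i], its angular velocity.  The next frame is
    obtained from this one by a rotation of angle [l_i] about [n_i] (slide along
    the edge) followed by a rotation of angle [e theta_(i+1)] about [v_(i+1)]
    (turn at the vertex), where [e] is [1] or [- 1] according to the side of the
    interior.  Angular velocities add up under composition, hence
      [om_(i+1) = om_i + dl_i n_i + (e dtheta_(i+1)) v_(i+1)]
    (lemma [frame_step]).  Since the dual point is [- e n_i], summing
    around the polygon gives the identity of the theorem, multiplied by [e].

    Conversely the identity says precisely that the recursion above can be solved
    cyclically in [om] for the given variations (lemma [closing_sum_eq0]), the
    solution being unique up to a constant, and one puts [V_i = om_i x v_i].  That
    these are the actual variations along [V] comes from two facts.  A family
    [(om, dl, dtheta)] that satisfies the recursion is determined by [V] (lemma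
    [angular_velocities_uniq]): looking at both ends of the edge [i], two such
    [om_i] coincide because [v_i], [v_(i+1)] and [n_i] are independent, [l_i]
    being neither [0] nor [pi].  And every [V] tangent to the sphere is the
    velocity of some path of polygons (lemma [first_order_variation_exists]),
    along which some triple exists, hence the same one.  Adding a constant [a]
    to [om] adds [a x v_i] to [V_i], and the maps [a x -] are exactly the
    infinitesimal isometries (lemma [trivial_deformationP]). *)

(** * Vector algebra in dimension three *)

Section VectorAlgebra.
Context {R : realType}.
Implicit Types (a b c v x y : 'rV[R]_3) (k : R).

Lemma dotvE x y :
  dotv x y = x 0 0 * y 0 0 + x 0 1 * y 0 1 + x 0 (2%:R) * y 0 (2%:R).
Proof.
rewrite /dotv !big_ord_recl big_ord0 addr0 addrA.
by congr (_ * _ + _ * _ + _ * _); congr (_ 0 _); apply/val_inj.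
Qed.

Lemma crossv0E x y :
  crossv x y 0 0 = x 0 1 * y 0 (2%:R) - x 0 (2%:R) * y 0 1.
Proof. by rewrite mxE; congr (_ * _ - _ * _); congr (_ 0 _); apply/val_inj. Qed.

Lemma crossv1E x y :
  crossv x y 0 1 = x 0 (2%:R) * y 0 0 - x 0 0 * y 0 (2%:R).
Proof. by rewrite mxE; congr (_ * _ - _ * _); congr (_ 0 _); apply/val_inj. Qed.

Lemma crossv2E x y :
  crossv x y 0 (2%:R) = x 0 0 * y 0 1 - x 0 1 * y 0 0.
Proof. by rewrite mxE; congr (_ * _ - _ * _); congr (_ 0 _); apply/val_inj. Qed.

Lemma row3P x y :
  x 0 0 = y 0 0 -> x 0 1 = y 0 1 -> x 0 (2%:R) = y 0 (2%:R) -> x = y.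
Proof.
move=> e0 e1 e2; apply/rowP => -[[|[|[|//]]] h].
- by have -> : Ordinal h = 0 by apply/val_inj.
- by have -> : Ordinal h = 1 by apply/val_inj.
- by have -> : Ordinal h = 2%:R by apply/val_inj.
Qed.

Local Ltac coordinates :=
  try apply: row3P;
  rewrite ?(dotvE, crossv0E, crossv1E, crossv2E, mxE); ring.

Lemma dotvC x y : dotv x y = dotv y x.
Proof. by coordinates. Qed.
Lemma dotvDl a x y : dotv (x + y) a = dotv x a + dotv y a.
Proof. by coordinates. Qed.
Lemma dotvZl k x y : dotv (k *: x) y = k * dotv x y.
Proof. by coordinates. Qed.
Lemma dotvNl x y : dotv (- x) y = - dotv x y.
Proof. by coordinates. Qed.
Lemma dotvDr a x y : dotv a (x + y) = dotv a x + dotv a y.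
Proof. by coordinates. Qed.
Lemma dotvZr k x y : dotv x (k *: y) = k * dotv x y.
Proof. by coordinates. Qed.
Lemma dotvNr x y : dotv x (- y) = - dotv x y.
Proof. by coordinates. Qed.
Definition dotv_lin := (dotvDl, dotvDr, dotvNl, dotvNr, dotvZl, dotvZr).

Lemma crossvC x y : crossv x y = - crossv y x.
Proof. by coordinates. Qed.
Lemma crossvDl a x y : crossv (x + y) a = crossv x a + crossv y a.
Proof. by coordinates. Qed.
Lemma crossvZl k x y : crossv (k *: x) y = k *: crossv x y.
Proof. by coordinates. Qed.
Lemma crossvNl x y : crossv (- x) y = - crossv x y.
Proof. by coordinates. Qed.
Lemma crossvDr a x y : crossv a (x + y) = crossv a x + crossv a y.
Proof. by coordinates. Qed.
Lemma crossvZr k x y : crossv x (k *: y) = k *: crossv x y.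
Proof. by coordinates. Qed.
Lemma crossvNr x y : crossv x (- y) = - crossv x y.
Proof. by coordinates. Qed.
Lemma crossvv x : crossv x x = 0.
Proof. by coordinates. Qed.
Definition crossv_lin :=
  (crossvDl, crossvDr, crossvNl, crossvNr, crossvZl, crossvZr).

Lemma crossv_crossr a b c :
  crossv a (crossv b c) = dotv a c *: b - dotv a b *: c.
Proof. by coordinates. Qed.
Lemma crossv_crossl a b c :
  crossv (crossv a b) c = dotv a c *: b - dotv b c *: a.
Proof. by coordinates. Qed.
Lemma dotv_crossl x y : dotv x (crossv x y) = 0.
Proof. by coordinates. Qed.
Lemma dotv_crossr x y : dotv y (crossv x y) = 0.
Proof. by coordinates. Qed.
Lemma dotv_cross_cross x y :
  dotv (crossv x y) (crossv x y) = dotv x x * dotv y y - dotv x y ^+ 2.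
Proof. by coordinates. Qed.
Lemma dotv_crossvA a b c : dotv a (crossv b c) = dotv (crossv a b) c.
Proof. by coordinates. Qed.

Lemma crossv_jacobi a b c :
  crossv a (crossv b c) = crossv (crossv a b) c + crossv b (crossv a c).
Proof. by coordinates. Qed.

Lemma dotvv_ge0 x : 0 <= dotv x x.
Proof. by rewrite dotvE; nra. Qed.

Lemma dotv_delta v j : dotv v (delta_mx 0 j) = v 0 j.
Proof.
rewrite /dotv (bigD1 j)//= mxE !eqxx mulr1 big1 ?addr0// => k kj.
by rewrite mxE (negbTE kj) andbF mulr0.
Qed.

End VectorAlgebra.

(** * Orthonormal frames and their angular velocities *)

Section Frames.
Context {R : realType}.
Implicit Types (b d v w x y : 'rV[R]_3) (k : R).

Local Ltac linear_combination := apply/rowP => ?; rewrite !mxE; ring.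

Definition orthonormal2 x y := [/\ dotv x x = 1, dotv y y = 1 & dotv x y = 0].

Lemma orthonormal2_decomp v d x : orthonormal2 v d ->
  x = dotv x v *: v + dotv x d *: d + dotv x (crossv v d) *: crossv v d.
Proof.
move=> [vv dd vd]; set n := crossv v d.
have nn : dotv n n = 1 by rewrite dotv_cross_cross vv dd vd; ring.
have xn : x - dotv x n *: n = crossv n (crossv x n).
  by rewrite crossv_crossr nn scale1r [dotv n x]dotvC.
rewrite -[LHS](subrK (dotv x n *: n)) xn.
rewrite [crossv x n]crossv_crossr !crossv_lin !crossv_crossl.
rewrite vv dd vd [dotv d v]dotvC vd; congr (_ + _).
by apply: row3P; rewrite !mxE; ring.
Qed.

Lemma crossv_orthonormal2 v d : orthonormal2 v d ->
  crossv (crossv v d) v = d /\ crossv (crossv v d) d = - v.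
Proof.
move=> [vv dd vd]; rewrite !crossv_crossl vv dd vd [dotv d v]dotvC vd.
by rewrite !scale1r !scale0r subr0 sub0r.
Qed.

Lemma crossv_eq0_collinear v w : dotv v v = 1 -> crossv w v = 0 ->
  w = dotv w v *: v.
Proof.
move=> vv wv; have := crossv_crossr v w v.
have v0 : crossv v 0 = 0.
  by rewrite -[X in crossv v X](subrr v) crossvDr crossvNr subrr.
rewrite wv v0 vv scale1r.
by move/esym/eqP; rewrite subr_eq0 [dotv v w]dotvC => /eqP.
Qed.

(** The hypotheses on [V] and [D] are the derivatives of the orthonormality
    relations: a first-order motion of an orthonormal frame is a rotation. *)
Lemma orthonormal2_velocity v d V D : orthonormal2 v d ->
  dotv v V = 0 -> dotv d D = 0 -> dotv V d + dotv v D = 0 ->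
  exists2 w, V = crossv w v & D = crossv w d.
Proof.
move=> vd_on vV dD VdvD; have [vv dd vd] := vd_on.
exists (crossv v V + dotv D (crossv v d) *: v).
  rewrite crossvDl crossvZl crossvv scaler0 addr0 crossv_crossl.
  by rewrite vv [dotv V v]dotvC vV scale1r scale0r subr0.
rewrite {1}(orthonormal2_decomp D vd_on) [dotv D d]dotvC dD scale0r addr0.
rewrite crossvDl crossvZl crossv_crossl vd scale0r sub0r -scaleNr.
by congr (_ *: _ + _); apply/eqP; rewrite [dotv D v]dotvC -addr_eq0 addrC VdvD.
Qed.

Lemma orthonormal2_velocity_uniq v d w1 w2 : orthonormal2 v d ->
  crossv w1 v = crossv w2 v -> crossv w1 d = crossv w2 d -> w1 = w2.
Proof.
move=> vd_on; have [vv dd vd] := vd_on => e1 e2.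
have cv : crossv (w1 - w2) v = 0 by rewrite crossvDl crossvNl e1 subrr.
have cd : crossv (w1 - w2) d = 0 by rewrite crossvDl crossvNl e2 subrr.
apply/eqP; rewrite -subr_eq0; apply/eqP.
rewrite (crossv_eq0_collinear vv cv) [X in dotv X v](crossv_eq0_collinear dd cd).
by rewrite dotvZl [dotv d v]dotvC vd mulr0 scale0r.
Qed.

(** Rotating the pair [v], [d] by the angle [l] in its plane gives the endpoint
    of the arc and the opposite of its final velocity. *)
Lemma orthonormal2_rotate v d l : orthonormal2 v d ->
  orthonormal2 (cos l *: v + sin l *: d) (sin l *: v - cos l *: d).
Proof.
move=> [vv dd vd]; have := cos2Dsin2 l.
split; rewrite !dotv_lin vv dd [dotv d v]dotvC vd; [nra|nra|ring].
Qed.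

Lemma crossv_rotate v d l : orthonormal2 v d ->
  crossv (crossv v d) (cos l *: v + sin l *: d) = - (sin l *: v - cos l *: d)
  /\ crossv (crossv v d) (sin l *: v - cos l *: d) =
     cos l *: v + sin l *: d.
Proof.
move=> /crossv_orthonormal2[nv nd]; rewrite !crossv_lin nv nd.
by split; linear_combination.
Qed.

(** The last two hypotheses are the derivatives of the two before them, for
    frames [v], [d] and [v'], [d'] of angular velocities [w] and [w'].  Both
    [w' + (e * da) *: v'] and [w + dl *: crossv v d] are therefore the angular
    velocity of the frame made, at the end of the arc, of [v'] and of the
    backward direction of the arc: computed from the second frame, or transported
    along the arc from the first one. *)
Lemma frame_step v d v' d' w w' l dl a da e :
  orthonormal2 v d -> orthonormal2 v' d' -> e ^+ 2 = 1 ->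
  v' = cos l *: v + sin l *: d ->
  sin l *: v - cos l *: d = cos a *: d' + sin a *: (e *: crossv v' d') ->
  crossv w' v' =
    (- sin l * dl) *: v + cos l *: crossv w v +
    ((cos l * dl) *: d + sin l *: crossv w d) ->
  (cos l * dl) *: v + sin l *: crossv w v -
    ((- sin l * dl) *: d + cos l *: crossv w d) =
  (- sin a * da) *: d' + cos a *: crossv w' d' +
    ((cos a * da) *: (e *: crossv v' d') +
     sin a *: (e *: (crossv (crossv w' v') d' + crossv v' (crossv w' d')))) ->
  w' = w + dl *: crossv v d + (e * - da) *: v'.
Proof.
move=> vd vd' e2 v'E bE v'_der b_der.
have [nv' nb] := crossv_rotate l vd.
have on' := orthonormal2_rotate l vd; rewrite -v'E in on' nv' nb.
suff : w' - (e * - da) *: v' = w + dl *: crossv v d.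
  by move=> <-; rewrite subrK.
apply: (orthonormal2_velocity_uniq on').
  rewrite !crossvDl crossvNl !crossvZl crossvv v'_der nv' v'E !crossv_lin.
  move: (crossv w v) (crossv w d) => x y; linear_combination.
have -> : crossv (w + dl *: crossv v d) (sin l *: v - cos l *: d) =
    (cos l * dl) *: v + sin l *: crossv w v -
    ((- sin l * dl) *: d + cos l *: crossv w d).
  rewrite crossvDl crossvZl nb v'E crossvDr crossvNr !crossvZr.
  move: (crossv w v) (crossv w d) => x y; linear_combination.
have v'n' : crossv v' (crossv v' d') = - d'.
  have [vv' _ vd'0] := vd'.
  by rewrite crossv_crossr vv' vd'0 scale0r scale1r sub0r.
rewrite b_der -crossv_jacobi bE crossvDl crossvNl crossvZl.
rewrite !crossvDr !crossvZr v'n'.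
move: (crossv w' d') (crossv w' _) (crossv v' d') => x y z.
apply/rowP => j; rewrite !mxE; ring: e2.
Qed.

(** [crossv w v = 0] makes [w] a multiple of [v], and likewise the sum in the
    last hypothesis is a multiple of [v']; [v], [v'] and [crossv v d] are
    independent as soon as [sin l] is not zero. *)
Lemma arc_velocity_inj v d v' l w k : orthonormal2 v d -> dotv v' v' = 1 ->
  sin l != 0 -> v' = cos l *: v + sin l *: d ->
  crossv w v = 0 -> crossv (w + k *: crossv v d) v' = 0 -> w = 0 /\ k = 0.
Proof.
move=> vd v'v' sin0 v'E wv wv'; have [vv dd vd0] := vd.
have nn1 : dotv (crossv v d) (crossv v d) = 1.
  by rewrite dotv_cross_cross vv dd vd0 expr0n mulr1 subr0.
have wE := crossv_eq0_collinear vv wv.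
have := crossv_eq0_collinear v'v' wv'.
move: (dotv w v) (dotv _ v') wE => a b -> wE'.
have k0 : k = 0.
  have := congr1 (fun y => dotv y (crossv v d)) wE'.
  by rewrite v'E !dotv_lin nn1 dotv_crossl dotv_crossr !(mulr0, add0r) mulr1.
rewrite k0 scale0r addr0 v'E in wE'.
have : b * sin l = 0.
  have := congr1 (fun y => dotv y d) wE'; rewrite !dotv_lin vd0 dd => e.
  by rewrite !mulr0 add0r mulr1 in e.
move/eqP; rewrite mulf_eq0 (negbTE sin0) orbF => /eqP b0.
by rewrite wE' b0 scale0r.
Qed.

Lemma arc_direction v v' (s : R) : dotv v v = 1 -> dotv v' v' = 1 ->
  dotv v v' ^+ 2 + s ^+ 2 = 1 -> s != 0 ->
  orthonormal2 v (s^-1 *: (v' + - dotv v v' *: v)) /\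
  v' = dotv v v' *: v + s *: (s^-1 *: (v' + - dotv v v' *: v)).
Proof.
set c := dotv v v' => vv vv' cs s0; split; last first.
  by rewrite scalerA divff// scale1r addrC scaleNr subrK.
split=> //; rewrite !dotv_lin vv ?vv' ?[dotv v' v]dotvC -/c; last by ring.
transitivity ((s ^+ 2)^-1 * (1 - c ^+ 2)); first by field.
have -> : 1 - c ^+ 2 = s ^+ 2 by lra.
by rewrite mulVf// expf_neq0.
Qed.

(** For [e] the orientation of a polygon and [v], [d] one of its frames, [n] is
    the direction that points to the interior. *)
Lemma tangent_decomp v d b e : orthonormal2 v d -> e ^+ 2 = 1 ->
  dotv v b = 0 -> dotv b b = 1 ->
  let n := e *: crossv v d in
  b = dotv b d *: d + dotv b n *: n /\ dotv b d ^+ 2 + dotv b n ^+ 2 = 1.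
Proof.
move=> vd e2 vb bb n; have b_dec := orthonormal2_decomp b vd.
rewrite [dotv b v]dotvC vb scale0r add0r in b_dec.
have b_n : dotv b (crossv v d) *: crossv v d = dotv b n *: n.
  by rewrite /n dotvZr scalerA mulrAC -expr2 e2 mul1r.
split; first by rewrite -b_n.
have := congr1 (dotv b) b_dec; rewrite bb b_n !dotv_lin => ->.
by rewrite !expr2.
Qed.

End Frames.

(** * Derivatives of vector-valued paths *)

Section VectorDerivatives.
Context {R : realType}.
Implicit Types (t : R) (f g : R -> R) (x y : R -> 'rV[R]_3).

Lemma near_is_derive_eq (W : normedModType R) (f g : R -> W) (t : R) (df dg : W) :
  (\forall u \near t, f u = g u) ->
  is_derive t (1 : R) f df -> is_derive t (1 : R) g dg -> df = dg.
Proof. by move=> fg [_ <-] [_ <-]; apply: near_eq_derive. Qed.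

Lemma is_derive_mxP m n (M : R -> 'M[R]_(m, n)) t (dM : 'M[R]_(m, n)) :
  is_derive t (1 : R) M dM <->
  forall i j, is_derive t (1 : R) (fun u => M u i j) (dM i j).
Proof.
split=> [[M_der <-] i j|M_der].
  rewrite derive_mx// mxE; apply: derivableP.
  by move/derivable_mxP : M_der; apply.
have M_d : derivable M t 1.
  by apply/derivable_mxP => i j; apply: ex_derive.
apply: DeriveDef => //; rewrite derive_mx//; apply/matrixP => i j.
by rewrite mxE; apply: derive_val.
Qed.

Lemma is_derive_rowP x t dx :
  is_derive t (1 : R) x dx <->
  forall j, is_derive t (1 : R) (fun u => x u 0 j) (dx 0 j).
Proof.
split=> [/is_derive_mxP//|h]; apply/is_derive_mxP => i j.
by rewrite (ord1 i).
Qed.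

Lemma is_derive_mulr f g t df dg :
  is_derive t (1 : R) f df -> is_derive t (1 : R) g dg ->
  is_derive t (1 : R) (fun u => f u * g u) (df * g t + f t * dg).
Proof.
move=> hf hg; apply: (is_derive_eq (is_deriveM hf hg)).
by rewrite addrC [X in X + _]mulrC.
Qed.

Lemma is_derive_scaler m n f (x : R -> 'M[R]_(m, n)) t df dx :
  is_derive t (1 : R) f df -> is_derive t (1 : R) x dx ->
  is_derive t (1 : R) (fun u => f u *: x u) (df *: x t + f t *: dx).
Proof.
move=> hf /is_derive_mxP hx; apply/is_derive_mxP => i j; rewrite !mxE.
have -> : (fun u => (f u *: x u) i j) = (fun u => f u * x u i j).
  by apply/funext => u; rewrite mxE.
exact: is_derive_mulr.
Qed.

Lemma is_derive_dotv x y t dx dy :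
  is_derive t (1 : R) x dx -> is_derive t (1 : R) y dy ->
  is_derive t (1 : R) (fun u => dotv (x u) (y u)) (dotv dx (y t) + dotv (x t) dy).
Proof.
move=> /is_derive_rowP hx /is_derive_rowP hy.
have -> : (fun u => dotv (x u) (y u)) =
          \sum_(k < 3) (fun u => x u 0 k * y u 0 k).
  by apply/funext => u; rewrite /dotv fct_sumE.
apply: (@is_derive_eq _ _ _ _ _ _ _
  (\sum_(k < 3) (dx 0 k * y t 0 k + x t 0 k * dy 0 k))).
  by apply: is_derive_sum => k; apply: is_derive_mulr.
by rewrite /dotv big_split.
Qed.

Lemma is_derive_crossv x y t dx dy :
  is_derive t (1 : R) x dx -> is_derive t (1 : R) y dy ->
  is_derive t (1 : R) (fun u => crossv (x u) (y u))
    (crossv dx (y t) + crossv (x t) dy).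
Proof.
move=> /is_derive_rowP hx /is_derive_rowP hy; apply/is_derive_rowP => k.
have -> : (fun u => crossv (x u) (y u) 0 k) =
  (fun u => x u 0 (ordS k) * y u 0 (ordS (ordS k)))
  - (fun u => x u 0 (ordS (ordS k)) * y u 0 (ordS k)).
  by apply/funext => u; rewrite mxE.
apply: (is_derive_eq (is_deriveB (is_derive_mulr (hx _) (hy _))
  (is_derive_mulr (hx _) (hy _)))).
by rewrite !mxE; ring.
Qed.

Lemma is_derive_even_quadratic k :
  is_derive (0 : R) (1 : R) (fun t => 1 + t * t * k) 0.
Proof.
have t_der := is_derive_id (0 : R) (1 : R).
apply: (is_derive_eq (is_deriveD (is_derive_cst (1 : R) (0 : R) (1 : R))
  (is_derive_mulr (is_derive_mulr t_der t_der)
    (is_derive_cst k (0 : R) (1 : R))))).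
by rewrite !(mul0r, mulr0, addr0).
Qed.

Lemma is_derive_cos_comp f t df : is_derive t (1 : R) f df ->
  is_derive t (1 : R) (fun u => cos (f u)) (- sin (f t) * df).
Proof. by move=> hf; apply: is_derive1_comp. Qed.

Lemma is_derive_sin_comp f t df : is_derive t (1 : R) f df ->
  is_derive t (1 : R) (fun u => sin (f u)) (cos (f t) * df).
Proof. by move=> hf; apply: is_derive1_comp. Qed.

Lemma is_derive_continuous (W : normedModType R) (f : R -> W) t df :
  is_derive t (1 : R) f df -> {for t, continuous f}.
Proof.
by move=> [h _]; apply/differentiable_continuous/derivable1_diffP.
Qed.

Lemma is_derive_gt f t df k : is_derive t (1 : R) f df -> k < f t ->
  \forall u \near t, k < f u.
Proof.
by move=> /is_derive_continuous h kf; exact: (cvgr_gt _ h _ kf).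
Qed.

Lemma is_derive_lt f t df k : is_derive t (1 : R) f df -> f t < k ->
  \forall u \near t, f u < k.
Proof.
by move=> /is_derive_continuous h kf; exact: (cvgr_lt _ h _ kf).
Qed.

End VectorDerivatives.

(** * Lifting points, arcs and angles to differentiable paths *)

Section Paths.
Context {R : realType}.
Implicit Types (v d : 'rV[R]_3) (x y b : R -> 'rV[R]_3).

Lemma sin_neq0 (a : R) : 0 <= a < 2 * pi -> a != 0 -> a != pi -> sin a != 0.
Proof.
move=> /andP[a0 a2] an0 anpi.
have [alt|agt|/eqP] := ltgtP a pi; last by rewrite (negbTE anpi).
  by rewrite gt_eqF// sin_gt0_pi// lt_def an0 a0.
have -> : sin a = - sin (a - pi) by rewrite -sinDpi subrK.
rewrite oppr_eq0 gt_eqF// sin_gt0_pi// subr_gt0 agt /=; lra.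
Qed.

(** Near [t] the angle is [a] plus the arcsine of the sine of the
    difference, which is close to [0]. *)
Lemma angle_lift (c s : R -> R) t dc ds a :
  is_derive t (1 : R) c dc -> is_derive t (1 : R) s ds ->
  (\forall u \near t, c u ^+ 2 + s u ^+ 2 = 1) ->
  c t = cos a -> s t = sin a ->
  exists f, [/\ f t = a, (exists df, is_derive t (1 : R) f df) &
    \forall u \near t, cos (f u) = c u /\ sin (f u) = s u].
Proof.
move=> hc hs cs1 ct st.
(* Sine and cosine of the difference between the angle sought and [a]. *)
pose sd u := s u * cos a - c u * sin a.
pose cd u := c u * cos a + s u * sin a.
have sdt : sd t = 0 by rewrite /sd ct st; ring.
have cdt : cd t = 1 by rewrite /cd ct st -!expr2 cos2Dsin2.
have ca := is_derive_cst (cos a) t (1 : R).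
have sa := is_derive_cst (sin a) t (1 : R).
have hsd := is_deriveB (is_derive_mulr hs ca) (is_derive_mulr hc sa).
have hcd := is_deriveD (is_derive_mulr hc ca) (is_derive_mulr hs sa).
have cs2 := cos2Dsin2 a.
exists (fun u => a + asin (sd u)); split.
- rewrite sdt -[X in asin X]sin0 sinK ?addr0// in_itv/=.
  by have := pi_gt0 R; lra.
- exists (0 + (Num.sqrt (1 - (sd t) ^+ 2))^-1 *
    (ds * cos a + s t * 0 - (dc * sin a + c t * 0))).
  apply: (is_deriveD (f := cst a)).
  apply: is_derive1_comp; apply: is_derive1_asin.
  by rewrite sdt; lra.
- have cd_gt0 : \forall u \near t, 0 < cd u.
    by apply: (is_derive_gt hcd); rewrite [ltRHS]cdt.
  near=> u.
  have csu : c u ^+ 2 + s u ^+ 2 = 1 by near: u.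
  have cdu : 0 < cd u by near: u.
  have e : cd u ^+ 2 + sd u ^+ 2 = 1.
    transitivity ((c u ^+ 2 + s u ^+ 2) * (cos a ^+ 2 + sin a ^+ 2)).
      by rewrite /cd /sd; ring.
    by rewrite csu cs2 mulr1.
  have sdu : -1 <= sd u <= 1 by apply/andP; split; nra.
  have sE : sin (asin (sd u)) = sd u by rewrite asinK// in_itv.
  have cE : cos (asin (sd u)) = cd u.
    rewrite cos_asin//; have -> : 1 - sd u ^+ 2 = cd u ^+ 2 by lra.
    by rewrite sqrtr_sqr gtr0_norm.
  rewrite cosD sinD sE cE /cd /sd; split.
    transitivity (c u * (cos a ^+ 2 + sin a ^+ 2)); first by ring.
    by rewrite cs2 mulr1.
  transitivity (s u * (cos a ^+ 2 + sin a ^+ 2)); first by ring.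
  by rewrite cs2 mulr1.
Unshelve. all: by end_near. Qed.

Lemma sphere_path v V : dotv v v = 1 -> dotv v V = 0 ->
  exists x, [/\ x 0 = v, is_derive (0 : R) (1 : R) x V &
    forall t, dotv (x t) (x t) = 1].
Proof.
move=> vv vV.
(* The squared norm of [v + t *: V], the point to be normalized. *)
pose q (t : R) := 1 + t * t * dotv V V.
have q_gt0 t : 0 < q t by have := dotvv_ge0 V; rewrite /q; nra.
have q0 : q 0 = 1 by rewrite /q !mul0r addr0.
exists (fun t => (Num.sqrt (q t))^-1 *: (v + t *: V)); split.
- by rewrite q0 sqrtr1 invr1 scale1r scale0r addr0.
- have idd := is_derive_id (0 : R) (1 : R).
  have cst_d (W : normedModType R) (w : W) := is_derive_cst w (0 : R) (1 : R).
  have hq : is_derive (0 : R) (1 : R) q 0 := is_derive_even_quadratic _.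
  have hs : is_derive (0 : R) (1 : R) (fun t => Num.sqrt (q t)) 0.
    apply: (is_derive_eq (is_derive1_comp (is_derive1_sqrt (q_gt0 0)) hq)).
    by rewrite mulr0.
  have s0 : Num.sqrt (q 0) != 0 by rewrite sqrtr_eq0 -ltNge.
  have hl : is_derive (0 : R) (1 : R) (fun t : R => v + t *: V) V.
    apply: (is_derive_eq (is_deriveD (cst_d _ v)
      (is_derive_scaler idd (cst_d _ V)))).
    by rewrite scale0r addr0 scale1r add0r.
  apply: (is_derive_eq (is_derive_scaler
    (@is_deriveV _ (fun t => Num.sqrt (q t)) _ _ _ s0 hs) hl)).
  rewrite !(scale0r, scaler0, scale1r, addr0, add0r).
  by rewrite q0 sqrtr1 invr1 scale1r.
- move=> t; rewrite !dotv_lin vv vV [dotv V v]dotvC vV.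
  have s0 : Num.sqrt (q t) != 0 by rewrite sqrtr_eq0 -ltNge.
  transitivity ((Num.sqrt (q t) ^+ 2)^-1 * q t).
    by move: (Num.sqrt _) s0 => r r0; rewrite /q; field.
  by rewrite sqr_sqrtr ?ltW// mulVf// gt_eqF.
Qed.

(** The cosine of the length is the scalar product of the endpoints and its
    sine is a square root, with the sign of [sin l], so that arcs longer than
    [pi] are covered; the direction is then read off the arc equation. *)
Lemma arc_path x y dx dy d l :
  is_derive (0 : R) (1 : R) x dx -> is_derive (0 : R) (1 : R) y dy ->
  (forall t, dotv (x t) (x t) = 1) -> (forall t, dotv (y t) (y t) = 1) ->
  orthonormal2 (x 0) d -> y 0 = cos l *: x 0 + sin l *: d -> sin l != 0 ->
  exists (L : R -> R) (D : R -> 'rV[R]_3),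
  [/\ L 0 = l /\ D 0 = d,
      exists dL, is_derive (0 : R) (1 : R) L dL,
      exists dD, is_derive (0 : R) (1 : R) D dD &
      \forall t \near (0 : R), orthonormal2 (x t) (D t) /\
        y t = cos (L t) *: x t + sin (L t) *: D t].
Proof.
move=> hx hy xx yy xd yE sl0.
pose c t := dotv (x t) (y t).
have hc := is_derive_dotv hx hy; rewrite -/c in hc.
have c0 : c 0 = cos l.
  have [_ _ xd0] := xd.
  by rewrite /c yE !dotv_lin xx xd0 mulr1 mulr0 addr0.
pose q t := 1 - c t * c t.
have hq := is_deriveB (is_derive_cst (1 : R) (0 : R) (1 : R))
  (is_derive_mulr hc hc).
have q0 : q 0 = sin l ^+ 2.
  by rewrite /q c0 -expr2; have := cos2Dsin2 l; lra.
have q0_gt0 : 0 < q 0 by rewrite q0 lt_def sqr_ge0 expf_neq0.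
have hsq := is_derive1_comp (is_derive1_sqrt q0_gt0) hq.
pose s t := Num.sg (sin l) * Num.sqrt (q t).
have hs := is_derive_mulr (is_derive_cst (Num.sg (sin l)) (0 : R) (1 : R)) hsq.
have s0 : s 0 = sin l by rewrite /s q0 sqrtr_sqr -numEsg.
have q_near : \forall t \near (0 : R), 0 < q t := is_derive_gt hq q0_gt0.
have cs : \forall t \near (0 : R), c t ^+ 2 + s t ^+ 2 = 1.
  apply: filterS q_near => t qt.
  rewrite /s exprMn sqr_sqrtr ?ltW// sqr_sg sl0 mul1r /q.
  by ring.
have [L [L0 Lder LE]] := angle_lift hc hs cs c0 s0.
pose D t := (s t)^-1 *: (y t + - c t *: x t).
exists L, D; split=> //.
- split=> //; rewrite /D s0 c0 yE scaleNr addrAC subrr add0r.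
  by rewrite scalerA mulVf// scale1r.
- have hi := is_deriveV _ hs.
  eexists; apply: is_derive_scaler; first by apply: hi; rewrite [X in X != 0]s0.
  by apply: is_deriveD; apply: is_derive_scaler; apply: is_deriveN.
- near=> t.
  have st0 : s t != 0.
    have qt : 0 < q t by near: t.
    by rewrite mulf_neq0 ?sgr_eq0// sqrtr_eq0 -ltNge.
  have [-> ->] : cos (L t) = c t /\ sin (L t) = s t by near: t.
  by apply: arc_direction => //; near: t.
Unshelve. all: by end_near. Qed.

(** The angle is lifted from the coordinates of the unit vector [b t] in the
    orthonormal basis [y t], [e *: crossv (x t) (y t)] of the tangent plane. *)
Lemma angle_path x y b dx dy db a e :
  is_derive (0 : R) (1 : R) x dx -> is_derive (0 : R) (1 : R) y dy ->
  is_derive (0 : R) (1 : R) b db -> e ^+ 2 = 1 ->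
  (\forall t \near (0 : R),
    [/\ orthonormal2 (x t) (y t), dotv (x t) (b t) = 0 & dotv (b t) (b t) = 1]) ->
  b 0 = cos a *: y 0 + sin a *: (e *: crossv (x 0) (y 0)) ->
  exists A : R -> R,
  [/\ A 0 = a,
      exists dA, is_derive (0 : R) (1 : R) A dA &
      \forall t \near (0 : R),
        b t = cos (A t) *: y t + sin (A t) *: (e *: crossv (x t) (y t))].
Proof.
move=> hx hy hb e2 frame b0.
have hn : is_derive (0 : R) (1 : R) (fun t => e *: crossv (x t) (y t)) _ :=
  is_deriveZ e (is_derive_crossv hx hy).
have frame0 := nbhs_singleton frame.
have cs : \forall t \near (0 : R),
    b t = dotv (b t) (y t) *: y t +
      dotv (b t) (e *: crossv (x t) (y t)) *: (e *: crossv (x t) (y t)) /\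
    dotv (b t) (y t) ^+ 2 + dotv (b t) (e *: crossv (x t) (y t)) ^+ 2 = 1.
  by apply: filterS frame => t [xd xb bb]; exact: tangent_decomp.
have [[xx yy xy] _ _] := frame0.
have ca : dotv (b 0) (y 0) = cos a.
  rewrite b0 !dotv_lin yy [dotv (crossv _ _) _]dotvC dotv_crossr.
  by rewrite !mulr0 addr0 mulr1.
have sa : dotv (b 0) (e *: crossv (x 0) (y 0)) = sin a.
  rewrite b0 !dotv_lin dotv_crossr dotv_cross_cross xx yy xy.
  by ring: e2.
have cs1 : \forall t \near (0 : R), dotv (b t) (y t) ^+ 2 +
    dotv (b t) (e *: crossv (x t) (y t)) ^+ 2 = 1.
  by apply: filterS cs => t [].
have [A [A0 Ader AE]] := angle_lift (is_derive_dotv hb hy)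
  (is_derive_dotv hb hn) cs1 ca sa.
exists A; split=> //; near=> t.
have [-> ->] : cos (A t) = dotv (b t) (y t) /\
    sin (A t) = dotv (b t) (e *: crossv (x t) (y t)) by near: t.
by have [] := near cs t.
Unshelve. all: by end_near. Qed.

End Paths.

(** * Difference equations around a cycle *)

Section Cyclic.
Context {Z : zmodType} {n : nat}.
Implicit Types (f d : 'I_n -> Z).

Lemma cyclic_sum_diff f d : (forall i, f (ordS i) = f i + d i) ->
  \sum_i d i = 0.
Proof.
move=> fd; apply: (@addrI _ (\sum_i f i)); rewrite addr0 -big_split /=.
by rewrite [RHS](reindex_inj (@ordS_inj n)); apply: eq_bigr => i _; rewrite fd.
Qed.

Lemma cyclic_primitive d : \sum_i d i = 0 ->
  exists f, forall i, f (ordS i) = f i + d i.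
Proof.
move=> d0; exists (fun i => \sum_(j < n | (j < i)%N) d j) => i.
have -> : \sum_(j < n | (j < i)%N) d j + d i = \sum_(j < n | (j <= i)%N) d j.
  rewrite [RHS](bigD1 i)//= addrC; congr (_ + _); apply: eq_bigl => j.
  by rewrite ltn_neqAle andbC.
(* The successor of the last index is [0], with an empty sum on the left and
   the sum of all the [d j] on the right. *)
have := ltn_ord i; rewrite leq_eqVlt => /predU1P[iE|lt_in].
  rewrite /= iE modnn big_pred0//; rewrite -[LHS]d0; apply: eq_bigl => j.
  by rewrite -ltnS iE ltn_ord.
by rewrite /= modn_small.
Qed.

Lemma cyclic_constant f : (forall i, f (ordS i) = f i) ->
  exists a, forall i, f i = a.
Proof.
case: n f => [|m] f fS; first by exists 0 => i; have := ltn_ord i.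
exists (f ord0) => -[k k_lt]; elim: k k_lt => [|k IHk] k_lt.
  by congr f; apply/val_inj.
rewrite -(IHk (ltnW k_lt)) -[RHS]fS; congr f; apply/val_inj.
by rewrite /= modn_small.
Qed.

End Cyclic.

(** * Infinitesimal isometries of the sphere *)

Section InfinitesimalIsometries.
Context {R : realType}.
Implicit Types (a v : 'rV[R]_3) (A B : 'M[R]_3).

Lemma mulmx3E v A j : (v *m A) 0 j =
  v 0 0 * A 0 j + v 0 1 * A 1 j + v 0 (2%:R) * A (2%:R) j.
Proof.
have e1 : lift ord0 ord0 = 1 :> 'I_3 by apply/val_inj.
have e2 : lift ord0 (lift ord0 ord0) = 2%:R :> 'I_3 by apply/val_inj.
by rewrite mxE !big_ord_recl big_ord0 addr0 addrA e2 e1.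
Qed.

Definition cross_mx a : 'M[R]_3 :=
  \matrix_(i, j) crossv a (delta_mx 0 i) 0 j.

Lemma mul_cross_mx a v : v *m cross_mx a = crossv a v.
Proof.
by apply: row3P; rewrite mulmx3E !(crossv0E, crossv1E, crossv2E, mxE) /=; ring.
Qed.

Lemma mulmx_inj A B : (forall v, v *m A = v *m B) -> A = B.
Proof. by move=> AB; apply/row_matrixP => i; rewrite !rowE. Qed.

Lemma cross_mx_tr a : (cross_mx a)^T = - cross_mx a.
Proof.
apply/matrixP => i j; rewrite mxE [LHS]mxE [RHS]mxE [in RHS]mxE -!dotv_delta.
by rewrite dotvC dotv_crossvA crossvC dotvNl.
Qed.

Lemma cross_mx_cube a :
  cross_mx a *m cross_mx a *m cross_mx a = - dotv a a *: cross_mx a.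
Proof.
apply: mulmx_inj => v; rewrite !mulmxA -scalemxAr !mul_cross_mx.
by rewrite crossv_crossr dotv_crossl scale0r sub0r scaleNr.
Qed.

(** The Cayley transform of [t / 2] times [A], expanded by means of
    [A ^ 3 = - r A], is a curve of orthogonal matrices with rational coefficients
    in [t] and velocity [A]. *)
Lemma infinitesimal_isometry_cross_mx a : infinitesimal_isometry (cross_mx a).
Proof.
set A := cross_mx a; set r := dotv a a.
have A3 : A *m A *m A = - r *: A := cross_mx_cube a.
pose q (t : R) := 1 + t * t * (r / 4).
have q_neq0 t : q t != 0.
  by rewrite gt_eqF// /q; have := dotvv_ge0 a; rewrite -/r; nra.
pose al t := t * (q t)^-1; pose be t := t * al t / 2.
exists (fun t => 1%:M + al t *: A + be t *: (A *m A)); split.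
- by rewrite /be /al !mul0r !scale0r !addr0.
- move=> t.
  have -> : (1%:M + al t *: A + be t *: (A *m A))^T =
      1%:M - al t *: A + be t *: (A *m A).
    rewrite !linearD/= !linearZ/= trmx1 trmx_mul cross_mx_tr -/A.
    by rewrite mulNmx mulmxN opprK scalerN.
  rewrite !(mulmxDl, mulmxDr, mulmxN, mul1mx, mulmx1) -!(scalemxAl, scalemxAr).
  rewrite !mulmxA A3 -!scalemxAl.
  move: (A *m A) => A2; clear A3; clearbody A.
  apply/matrixP => i j; rewrite !mxE /be /al.
  have := q_neq0 t; rewrite /q => q0.
  by field; rewrite gt_eqF//; have := dotvv_ge0 a; rewrite -/r; nra.
- have qi : is_derive (0 : R) (1 : R) (fun t => (q t)^-1) _ :=
    @is_deriveV _ q _ _ _ (q_neq0 0) (is_derive_even_quadratic _).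
  have t_der := is_derive_id (0 : R) (1 : R).
  have al_der : is_derive (0 : R) (1 : R) al 1.
    apply: (is_derive_eq (is_derive_mulr t_der qi)).
    by rewrite /q !(mul0r, mul1r) !addr0 invr1.
  have be_der : is_derive (0 : R) (1 : R) be 0.
    apply: (is_derive_eq (is_derive_mulr (is_derive_mulr t_der al_der)
      (is_derive_cst (2^-1 : R) (0 : R) (1 : R)))).
    by rewrite /al !(mul0r, mulr0, addr0).
  have al0 : al 0 = 0 by rewrite /al mul0r.
  have be0 : be 0 = 0 by rewrite /be !mul0r.
  have := is_deriveD (is_deriveD (is_derive_cst (1%:M : 'M[R]_3) _ _)
    (is_derive_scaler al_der (is_derive_cst A _ _)))
    (is_derive_scaler be_der (is_derive_cst (A *m A) _ _)).
  by rewrite al0 be0 scale1r !scaler0 scale0r !addr0 add0r.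
Qed.

(** Differentiating [g t *m (g t)^T = 1%:M] at [0] makes [A] antisymmetric. *)
Lemma infinitesimal_isometry_cross A : infinitesimal_isometry A ->
  exists a, A = cross_mx a.
Proof.
move=> [g [g0 g_orth g_der]].
have A_skew i j : A i j + A j i = 0.
  have /is_derive_mxP g_der' := g_der.
  have E : \forall t \near (0 : R),
      (\sum_k (fun u => g u i k * g u j k)) t = (1%:M : 'M[R]_3) i j.
    near=> t; rewrite fct_sumE -(g_orth t) mxE.
    by apply: eq_bigr => k _; rewrite mxE.
  have := near_is_derive_eq E (is_derive_sum (fun k =>
    is_derive_mulr (g_der' i k) (g_der' j k))) (is_derive_cst _ _ _).
  move=> <-; rewrite big_split/= g0; congr (_ + _).
    rewrite (bigD1 j)//= mxE eqxx mulr1 big1 ?addr0// => k kj.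
    by rewrite mxE eq_sym (negbTE kj) mulr0.
  rewrite (bigD1 i)//= mxE eqxx mul1r big1 ?addr0// => k ki.
  by rewrite mxE eq_sym (negbTE ki) mul0r.
have A_diag i : A i i = 0 by have := A_skew i i; lra.
have A_swap i j : A j i = - A i j by have := A_skew i j; lra.
exists (\row_j A (ordS j) (ordS (ordS j))); apply: mulmx_inj => v.
have e1 : ordS 0 = 1 :> 'I_3 by apply/val_inj.
have e2 : ordS 1 = 2%:R :> 'I_3 by apply/val_inj.
have e3 : ordS (2%:R) = 0 :> 'I_3 by apply/val_inj.
rewrite mul_cross_mx.
apply: row3P; rewrite mulmx3E !(crossv0E, crossv1E, crossv2E) !mxE !(e1, e2, e3).
- by rewrite A_diag (A_swap 0 1); ring.
- by rewrite A_diag (A_swap 1 (2%:R)); ring.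
- by rewrite A_diag (A_swap (2%:R) 0); ring.
Unshelve. all: by end_near. Qed.

Lemma trivial_deformationP n (p : polygon R n) (U : 'I_n -> 'rV[R]_3) :
  trivial_deformation p U <-> exists a, forall i, U i = crossv a (vtx p i).
Proof.
split=> [[A /infinitesimal_isometry_cross[a ->] UE]|[a UE]].
  by exists a => i; rewrite UE mul_cross_mx.
exists (cross_mx a); first exact: infinitesimal_isometry_cross_mx.
by move=> i; rewrite mul_cross_mx.
Qed.

End InfinitesimalIsometries.

(** * Angular velocities of a polygon *)

Section Polygons.
Context {R : realType} {n : nat}.
Implicit Types (p : polygon R n) (V om : 'I_n -> 'rV[R]_3).
Implicit Types (dl dth : 'I_n -> R).

Definition orientation p : R := if interior_left p then 1 else - 1.

Lemma orientation_sqr p : orientation p ^+ 2 = 1.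
Proof. by rewrite /orientation; case: ifP => _; rewrite ?sqrrN expr1n. Qed.

Lemma inwardE p i :
  inward p i = orientation p *: crossv (vtx p i) (dir p i).
Proof. by []. Qed.

(** The algebraic counterpart of [first_order_variation]: [om i] is the
    angular velocity of the frame at the vertex [i]. *)
Definition angular_velocities p V dl dth om : Prop :=
  (forall i, V i = crossv (om i) (vtx p i)) /\
  (forall i, om (ordS i) = om i + dl i *: crossv (vtx p i) (dir p i) +
     (orientation p * dth (ordS i)) *: vtx p (ordS i)).

Lemma is_polygon_frame p i : is_polygon p -> orthonormal2 (vtx p i) (dir p i).
Proof. by move=> /(_ i)[vv [dd vd] _ _ _]. Qed.

Lemma is_polygon_angle p i : is_polygon p ->
  sin (len p i) *: vtx p i - cos (len p i) *: dir p i =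
  cos (int_angle p (ordS i)) *: dir p (ordS i) +
  sin (int_angle p (ordS i)) *:
    (orientation p *: crossv (vtx p (ordS i)) (dir p (ordS i))).
Proof. by move=> /(_ (ordS i))[_ _ _ _]; rewrite ordSK. Qed.

Lemma is_polygon_dir p i : is_polygon p -> sin (len p i) != 0 ->
  dir p i = (sin (len p i))^-1 *:
    (vtx p (ordS i) + - cos (len p i) *: vtx p i).
Proof.
move=> /(_ i)[_ _ _ -> _] s0.
by rewrite scaleNr addrAC subrr add0r scalerA mulVf// scale1r.
Qed.

(** A path of polygons is only known to have differentiable vertices, lengths
    and angles; its directions are differentiable too because [sin (len p i)]
    does not vanish, and this gives the angular velocity of each frame. *)
Lemma first_order_variation_angular p V dl dth :
  (forall i, sin (len p i) != 0) ->
  first_order_variation p V dl dth ->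
  exists om, angular_velocities p V dl dth om.
Proof.
move=> sin0 [P [P0 Ppoly Vder lder thder]].
have lder' i := is_derive_sin_comp (lder i).
have lder'' i := is_derive_cos_comp (lder i).
have sin_near i : \forall t \near (0 : R), sin (len (P t) i) != 0.
  have h := is_derive_continuous (lder' i).
  by apply: (cvgr_neq0 _ h); rewrite P0 sin0.
have Dder i : exists D, is_derive (0 : R) (1 : R) (fun t => dir (P t) i) D.
  have dirE : \forall t \near (0 : R), (sin (len (P t) i))^-1 *:
    (vtx (P t) (ordS i) + - cos (len (P t) i) *: vtx (P t) i) = dir (P t) i.
    near=> t; rewrite -is_polygon_dir//; last by near: t; exact: sin_near.
    by have [] : is_polygon (P t) /\ interior_left (P t) = interior_left p
      by near: t.
  eexists; apply: (near_eq_is_derive dirE).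
  apply: is_derive_scaler; first by apply: is_deriveV; rewrite P0 sin0.
  by apply: is_deriveD; apply: is_derive_scaler; apply: is_deriveN.
have [D hD] := choice Dder.
have dot_der x y dx dy c : is_derive (0 : R) (1 : R) x dx ->
    is_derive (0 : R) (1 : R) y dy ->
    (\forall t \near (0 : R), dotv (x t) (y t) = c) ->
    dotv dx (y 0) + dotv (x 0) dy = 0.
  move=> hx hy hc.
  exact: (near_is_derive_eq hc (is_derive_dotv hx hy) (is_derive_cst c _ _)).
have pP : is_polygon p by have [] := nbhs_singleton Ppoly; rewrite P0.
have om_ex i : exists w, V i = crossv w (vtx p i) /\ D i = crossv w (dir p i).
  have frame_near : \forall t \near (0 : R),
      orthonormal2 (vtx (P t) i) (dir (P t) i).
    by apply: filterS Ppoly => t [/(is_polygon_frame i)].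
  have := dot_der _ _ _ _ 1 (Vder i) (Vder i).
  have := dot_der _ _ _ _ 1 (hD i) (hD i).
  have := dot_der _ _ _ _ 0 (Vder i) (hD i).
  rewrite !P0 => h1 h2 h3.
  have [||||w ? ?] := @orthonormal2_velocity _ (vtx p i) (dir p i) (V i) (D i).
  - exact: is_polygon_frame.
  - have : dotv (V i) (vtx p i) + dotv (vtx p i) (V i) = 0.
      by apply: h3; apply: filterS frame_near => t [].
    by rewrite [dotv (V i) _]dotvC; lra.
  - have : dotv (D i) (dir p i) + dotv (dir p i) (D i) = 0.
      by apply: h2; apply: filterS frame_near => t [].
    by rewrite [dotv (D i) _]dotvC; lra.
  - by apply: h1; apply: filterS frame_near => t [].
  - by exists w.
have [om hom] := choice om_ex; exists om; split=> [i|i]; first by have [] := hom i.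
have ader j : is_derive (0 : R) (1 : R) (fun t => int_angle (P t) j) (- dth j).
  have -> : (fun t => int_angle (P t) j) = cst pi - (fun t => ext_angle (P t) j).
    by apply/funext => t; rewrite /ext_angle !fctE/=; ring.
  by apply: (is_derive_eq (is_deriveB _ _)); rewrite sub0r.
(* [frame_step] is phrased with the interior angle, whose variation is
   [- dth (ordS i)]. *)
rewrite -[dth (ordS i)]opprK.
have [Vi Di] := hom i; have [Vi' Di'] := hom (ordS i).
have orP t : interior_left (P t) = interior_left p ->
    orientation (P t) = orientation p.
  by rewrite /orientation => ->.
apply: (@frame_step _ _ _ _ (dir p (ordS i)) _ _ (len p i) _
  (int_angle p (ordS i)) _ _) => //.
- exact: is_polygon_frame.
- exact: is_polygon_frame.
- exact: orientation_sqr.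
- by have [] := pP i.
- exact: is_polygon_angle.
- rewrite -Vi' -Vi -Di.
  have E : \forall t \near (0 : R), vtx (P t) (ordS i) =
     cos (len (P t) i) *: vtx (P t) i + sin (len (P t) i) *: dir (P t) i.
    by apply: filterS Ppoly => t [/(_ i)[]].
  rewrite (near_is_derive_eq E (Vder _) (is_deriveD
    (is_derive_scaler (lder'' i) (Vder i)) (is_derive_scaler (lder' i) (hD i)))).
  by rewrite P0.
- rewrite -Vi' -Vi -Di -Di'.
  have E : \forall t \near (0 : R),
    sin (len (P t) i) *: vtx (P t) i - cos (len (P t) i) *: dir (P t) i =
    cos (int_angle (P t) (ordS i)) *: dir (P t) (ordS i) +
    sin (int_angle (P t) (ordS i)) *:
    (orientation p *: crossv (vtx (P t) (ordS i)) (dir (P t) (ordS i))).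
    by apply: filterS Ppoly => t [pt /orP <-]; exact: is_polygon_angle.
  have := near_is_derive_eq E (is_deriveB
    (is_derive_scaler (lder' i) (Vder i)) (is_derive_scaler (lder'' i) (hD i)))
    (is_deriveD (is_derive_scaler (is_derive_cos_comp (ader _)) (hD _))
     (is_derive_scaler (is_derive_sin_comp (ader _))
       (is_deriveZ (orientation p) (is_derive_crossv (Vder _) (hD _))))).
  by rewrite /= !P0.
Unshelve. all: by end_near. Qed.

Lemma angular_velocities_uniq p V dl dth om dl' dth' om' :
  is_polygon p -> (forall i, sin (len p i) != 0) ->
  angular_velocities p V dl dth om -> angular_velocities p V dl' dth' om' ->
  [/\ om = om', dl = dl' & dth = dth'].
Proof.
move=> pP sin0 [Vom om_next] [Vom' om_next'].
have key i : om i = om' i /\ dl i = dl' i.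
  have [_ _ _ v'E _] := pP i.
  have [v'v' _ _] := is_polygon_frame (ordS i) pP.
  have next_vertex z l k : crossv (z + l *: crossv (vtx p i) (dir p i) +
      k *: vtx p (ordS i)) (vtx p (ordS i)) =
      crossv (z + l *: crossv (vtx p i) (dir p i)) (vtx p (ordS i)).
    by rewrite [LHS]crossvDl crossvZl crossvv scaler0 addr0.
  have [] := @arc_velocity_inj _ (vtx p i) (dir p i) (vtx p (ordS i))
    (len p i) (om i - om' i) (dl i - dl' i) _ v'v' (sin0 i) v'E.
  - exact: is_polygon_frame.
  - by rewrite crossvDl crossvNl -Vom -Vom' subrr.
  - have -> : om i - om' i + (dl i - dl' i) *: crossv (vtx p i) (dir p i) =
        om i + dl i *: crossv (vtx p i) (dir p i)
        - (om' i + dl' i *: crossv (vtx p i) (dir p i)).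
      by rewrite scalerBl opprD addrACA.
    rewrite crossvDl crossvNl -(next_vertex (om i) _ (orientation p * dth (ordS i))).
    rewrite -(next_vertex (om' i) _ (orientation p * dth' (ordS i))).
    by rewrite -om_next -om_next' -Vom -Vom' subrr.
  - by move=> /eqP + /eqP; rewrite !subr_eq0 => /eqP -> /eqP ->.
have omE : om = om' by apply/funext => i; have [] := key i.
have dlE : dl = dl' by apply/funext => i; have [] := key i.
split=> //; apply/funext => i; rewrite -(ord_predK i).
have := om_next (ord_pred i); rewrite omE dlE om_next' => /addrI.
have [vv _ _] := is_polygon_frame (ordS (ord_pred i)) pP.
move/(congr1 (fun y => dotv y (vtx p (ordS (ord_pred i))))).
rewrite !dotvZl vv !mulr1.
move/(congr1 ( *%R (orientation p))).
by rewrite !mulrA -expr2 orientation_sqr !mul1r.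
Qed.

(** The vertices are moved freely on the sphere, and the edges and angles
    follow: nothing has to be closed up, since consecutive vertices determine
    the arc between them near the given one. *)
Lemma first_order_variation_exists p V : is_polygon p ->
  (forall i, len p i != 0) -> (forall i, sin (len p i) != 0) ->
  deformation p V -> exists dl dth, first_order_variation p V dl dth.
Proof.
move=> pP len0 sin0 Vtan.
have frame i := is_polygon_frame i pP.
have vertex i : exists x, [/\ x 0 = vtx p i,
    is_derive (0 : R) (1 : R) x (V i) & forall t, dotv (x t) (x t) = 1].
  by have [vv _ _] := frame i; exact: sphere_path.
have [x hx] := choice vertex.
have x0 i : x i 0 = vtx p i by have [] := hx i.
have xV i : is_derive (0 : R) (1 : R) (x i) (V i) by have [] := hx i.
have xx i t : dotv (x i t) (x i t) = 1 by have [] := hx i.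
have edge i : exists (LD : (R -> R) * (R -> 'rV[R]_3)),
    [/\ LD.1 0 = len p i /\ LD.2 0 = dir p i,
      exists dL, is_derive (0 : R) (1 : R) LD.1 dL,
      exists dD, is_derive (0 : R) (1 : R) LD.2 dD &
      \forall t \near (0 : R), orthonormal2 (x i t) (LD.2 t) /\
        x (ordS i) t = cos (LD.1 t) *: x i t + sin (LD.1 t) *: LD.2 t].
  have xd : orthonormal2 (x i 0) (dir p i) by rewrite x0; exact: frame.
  have xE : x (ordS i) 0 = cos (len p i) *: x i 0 + sin (len p i) *: dir p i.
    by rewrite !x0; have [] := pP i.
  have [L [D h]] := arc_path (xV i) (xV (ordS i)) (xx i) (xx (ordS i)) xd xE
    (sin0 i).
  by exists (L, D).
have [LD hLD] := choice edge.
have L_der i : exists dL, is_derive (0 : R) (1 : R) (LD i).1 dL.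
  by have [] := hLD i.
have D_der i : exists dD, is_derive (0 : R) (1 : R) (LD i).2 dD.
  by have [] := hLD i.
have [dL hdL] := choice L_der; have [dD hdD] := choice D_der.
have LD0 i : (LD i).1 0 = len p i /\ (LD i).2 0 = dir p i by have [] := hLD i.
have arc_near i : \forall t \near (0 : R),
    orthonormal2 (x i t) ((LD i).2 t) /\
    x (ordS i) t = cos ((LD i).1 t) *: x i t + sin ((LD i).1 t) *: (LD i).2 t.
  by have [] := hLD i.
pose b i t := sin ((LD i).1 t) *: x i t - cos ((LD i).1 t) *: (LD i).2 t.
have b_der i : is_derive (0 : R) (1 : R) (b i) _ := is_deriveB
  (is_derive_scaler (is_derive_sin_comp (hdL i)) (xV i))
  (is_derive_scaler (is_derive_cos_comp (hdL i)) (hdD i)).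
have angle i : exists A : R -> R, [/\ A 0 = int_angle p i,
    exists dA, is_derive (0 : R) (1 : R) A dA &
    \forall t \near (0 : R), b (ord_pred i) t = cos (A t) *: (LD i).2 t +
      sin (A t) *: (orientation p *: crossv (x i t) ((LD i).2 t))].
  apply: (angle_path (xV i) (hdD i) (b_der (ord_pred i)) (orientation_sqr p)).
  - apply: filterS2 (arc_near i) (arc_near (ord_pred i)) => t [on_i _] [on_j xE].
    rewrite ord_predK in xE.
    have [_ bb xb] := orthonormal2_rotate ((LD (ord_pred i)).1 t) on_j.
    by rewrite -xE in xb.
  - rewrite /b !x0 !(LD0 _).1 !(LD0 _).2.
    by have := is_polygon_angle (ord_pred i) pP; rewrite ord_predK.
have [A hA] := choice angle.
have A_der i : exists dA, is_derive (0 : R) (1 : R) (A i) dA.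
  by have [] := hA i.
have [dA hdA] := choice A_der.
exists dL, (fun i => - dA i), (fun t => Polygon (fun i => x i t)
  (fun i => (LD i).2 t) (fun i => (LD i).1 t) (fun i => A i t)
  (interior_left p)); split.
- case: p pP x0 LD0 hA {len0 sin0 Vtan frame hx edge hLD angle vertex}.
  move=> v d l a il /= pP x0 LD0 hA.
  by congr Polygon; apply/funext => i; have [] := LD0 i; have [] := hA i.
- near=> t; split=> // i.
  have [on_i xE] : orthonormal2 (x i t) ((LD i).2 t) /\
    x (ordS i) t = cos ((LD i).1 t) *: x i t + sin ((LD i).1 t) *: (LD i).2 t.
    move: (i); near: t; apply: filter_forall => j; exact: arc_near.
  have bE : b (ord_pred i) t = cos (A i t) *: (LD i).2 t +
      sin (A i t) *: (orientation p *: crossv (x i t) ((LD i).2 t)).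
    by move: (i); near: t; apply: filter_forall => j; have [] := hA j.
  have [vv dd vd] := on_i.
  split=> //=.
  apply/andP; split; last first.
    move: (i); near: t; apply: filter_forall => j.
    apply: (is_derive_lt (hdL j)); rewrite (LD0 j).1.
    by have [_ _ /andP[]] := pP j.
  apply: ltW; move: (i); near: t; apply: filter_forall => j.
  apply: (is_derive_gt (hdL j)); rewrite (LD0 j).1 lt_def len0.
  by have [_ _ /andP[]] := pP j.
- by [].
- by [].
- move=> i; rewrite /ext_angle/=.
  apply: (is_derive_eq (is_deriveB (is_derive_cst (pi : R) _ _) (hdA i))).
  by rewrite sub0r.
Unshelve. all: by end_near. Qed.

(** An algebraic solution is an actual variation: the variations along some
    path of velocity [V] also solve the recursion, and the solution is unique. *)
Lemma first_order_variationP p V dl dth : is_polygon p ->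
  (forall i, len p i != 0) -> (forall i, sin (len p i) != 0) ->
  deformation p V ->
  first_order_variation p V dl dth <->
  exists om, angular_velocities p V dl dth om.
Proof.
move=> pP len0 sin0 Vtan; split; first exact: first_order_variation_angular.
move=> [om omV].
have [dl' [dth' var]] := first_order_variation_exists pP len0 sin0 Vtan.
have [om' omV'] := first_order_variation_angular sin0 var.
by have [_ -> ->] := angular_velocities_uniq pP sin0 omV omV'.
Qed.

Lemma closing_sumE p dl dth :
  \sum_(i < n) (dth i *: vtx p i - dl i *: dual_point p i) =
  orientation p *: \sum_(i < n) (dl i *: crossv (vtx p i) (dir p i) +
     (orientation p * dth (ordS i)) *: vtx p (ordS i)).
Proof.
rewrite !big_split/= addrC scalerDr !scaler_sumr; congr (_ + _).
  apply: eq_bigr => i _.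
  by rewrite /dual_point inwardE scalerN opprK !scalerA mulrC.
rewrite (reindex_inj (@ordS_inj n)); apply: eq_bigr => i _.
by rewrite scalerA mulrA -expr2 orientation_sqr mul1r.
Qed.

Lemma closing_sum_eq0 p dl dth :
  \sum_(i < n) (dth i *: vtx p i - dl i *: dual_point p i) = 0 <->
  exists om, angular_velocities p (fun i => crossv (om i) (vtx p i)) dl dth om.
Proof.
rewrite closing_sumE; split=> [/eqP|[om [_ om_next]]].
  rewrite scaler_eq0 -sqrf_eq0 orientation_sqr oner_eq0 => /eqP.
  move=> /cyclic_primitive[om om_next]; exists om; split=> // i.
  by rewrite om_next addrA.
rewrite (@cyclic_sum_diff _ _ om) ?scaler0// => i.
by rewrite om_next addrA.
Qed.

End Polygons.

(** * The variation formula and its converse *)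

Theorem theorem1p1 (R : realType) (n : nat) (p : polygon R n)
    (p_polygon : is_polygon p)
    (len_neq : forall i : 'I_n, len p i != 0 /\ len p i != pi) :
  (forall V : 'I_n -> 'rV[R]_3, deformation p V ->
     (exists! d : ('I_n -> R) * ('I_n -> R), first_order_variation p V d.1 d.2) /\
     (forall dl dtheta : 'I_n -> R, first_order_variation p V dl dtheta ->
        \sum_(i < n) (dtheta i *: vtx p i - dl i *: dual_point p i) = 0)) /\
  (forall l' theta' : 'I_n -> R,
     \sum_(i < n) (theta' i *: vtx p i - l' i *: dual_point p i) = 0 ->
     exists V : 'I_n -> 'rV[R]_3,
       [/\ deformation p V,
           first_order_variation p V l' theta'
         & forall W : 'I_n -> 'rV[R]_3, deformation p W ->
             (first_order_variation p W l' theta' <->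
              trivial_deformation p (fun i => W i - V i))]).
Proof.
have len0 i : len p i != 0 by have [] := len_neq i.
have sin0 i : sin (len p i) != 0.
  by have [? ?] := len_neq i; apply: sin_neq0 => //; have [] := p_polygon i.
have varP V dl dth := @first_order_variationP _ _ p V dl dth p_polygon len0 sin0.
split=> [V Vtan|l' theta'].
  split=> [|dl dth /(varP _ _ _ Vtan)[om [Vom om_next]]].
    have [dl [dth var]] := first_order_variation_exists p_polygon len0 sin0 Vtan.
    exists (dl, dth); split=> // -[dl' dth'] /= var'.
    have [om omV] := first_order_variation_angular sin0 var.
    have [om' omV'] := first_order_variation_angular sin0 var'.
    by have [_ -> ->] := angular_velocities_uniq p_polygon sin0 omV omV'.
  by apply/closing_sum_eq0; exists om.
move=> /closing_sum_eq0[om [_ om_next]].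
pose V i := crossv (om i) (vtx p i).
have Vtan : deformation p V by move=> i; rewrite dotv_crossr.
exists V; split=> //; first by apply/(varP _ _ _ Vtan); exists om.
move=> W Wtan; rewrite (varP _ _ _ Wtan) trivial_deformationP.
split=> [[om' [Wom' om'_next]]|[a WV]].
  have [i|a aE] := @cyclic_constant _ _ (fun i => om' i - om i).
    by rewrite om'_next om_next; do 2!rewrite opprD addrACA subrr addr0.
  by exists a => i; rewrite -(aE i) crossvDl crossvNl -Wom'.
exists (fun i => om i + a); split=> i.
  by rewrite crossvDl -WV addrC subrK.
by rewrite om_next -!addrA; congr (_ + _); rewrite addrA addrC.
Qed.
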